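(* Let $\mathcal{U}$ be a finite non-empty set of $n$ nodes of a directed graph in which every node has at least one outgoing edge, let $\mathcal{M}=\{\mathcal{D}_1,\dots,\mathcal{D}_K\}$ be a partition of $\mathcal{U}$ into non-empty blocks, and let $\mathbf{H}$, $\mathbf{M}=\mathbf{R}\mathbf{A}$ and $\mathbf{W}=\mathbf{A}\mathbf{R}$ be the associated hyperlink matrix, inter-level proximity matrix and indicator matrix. Let $\eta,\mu$ be positive real numbers with $\eta+\mu=1$. Then the matrix $\mathbf{P}=\eta\mathbf{H}+\mu\mathbf{M}$ is primitive if and only if the indicator matrix $\mathbf{W}$ is irreducible.
   Context: Irreducibility: a non-negative square matrix $\mathbf{T}$ is irreducible if for every pair of indices $i,j$ there is a positive integer $m=m(i,j)$ with $[\mathbf{T}^m]_{ij}>0$; otherwise it is reducible. The period of an index $i$ is the greatest common divisor of all positive integers $m$ with $[\mathbf{T}^m]_{ii}>0$; for an irreducible matrix all indices have the same period, called the period of the matrix. A matrix is primitive if it is irreducible with period $1$. Graph and hyperlink matrix: $\mathcal{U}=\{u_1,\dots,u_n\}$ is the node set of a directed graph. For a node $u$, $\mathcal{G}_u\subseteq\mathcal{U}$ is the set of nodes $v$ such that there is an edge from $u$ to $v$, and $d_u=|\mathcal{G}_u|$, assumed to be $\geq 1$ for every $u$. The hyperlink matrix $\mathbf{H}\in\mathbb{R}^{n\times n}$ has $[\mathbf{H}]_{uv}=1/d_u$ if $v\in\mathcal{G}_u$ and $0$ otherwise; it is row-stochastic. Decomposition: $\{\mathcal{D}_1,\dots,\mathcal{D}_K\}$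 is a partition of $\mathcal{U}$ into non-empty sets (blocks), and $\mathcal{D}_{(u)}$ is the unique block containing $u$. The proximal set of $u$ is $\mathcal{M}_u=\bigcup_{w\in\{u\}\cup\mathcal{G}_u}\mathcal{D}_{(w)}$. One writes $\mathcal{D}_j\in\mathcal{M}_u$ when $\mathcal{D}_j$ is one of the blocks in this union, i.e. $\mathcal{D}_j=\mathcal{D}_{(w)}$ for some $w\in\{u\}\cup\mathcal{G}_u$, and $N_u$ is the number of different such blocks. Inter-level proximity matrix: $\mathbf{M}\in\mathbb{R}^{n\times n}$ has $[\mathbf{M}]_{uv}=\frac{1}{N_u|\mathcal{D}_{(v)}|}$ if $v\in\mathcal{M}_u$ and $0$ otherwise. It factors as $\mathbf{M}=\mathbf{R}\mathbf{A}$, where $\mathbf{A}\in\mathbb{R}^{K\times n}$ has $[\mathbf{A}]_{kj}=1$ if $u_j\in\mathcal{D}_k$ and $0$ otherwise, and $\mathbf{R}\in\mathbb{R}^{n\times K}$ has $[\mathbf{R}]_{ij}=\frac{1}{N_{u_i}|\mathcal{D}_j|}$ if $\mathcal{D}_j\in\mathcal{M}_{u_i}$ and $0$ otherwise. Indicator matrix: $\mathbf{W}=\mathbf{A}\mathbf{R}\in\mathbb{R}^{K\times K}$. *)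

(* Defs.v *)
From mathcomp Require Import all_boot all_order all_algebra.

Set Implicit Arguments.
Unset Strict Implicit.
Unset Printing Implicit Defensive.

Import Order.TTheory GRing.Theory Num.Theory.
Local Open Scope ring_scope.

Section NonnegativeMatrices.

Variables (F : numFieldType) (n : nat).
Implicit Types (T : 'M[F]_n) (i : 'I_n) (d : nat).

Definition nonneg_mx T : Prop := forall i j, 0 <= T i j.

Definition irreducible_mx T : Prop :=
  nonneg_mx T /\
  forall i j, exists m : nat, (0 < m)%N /\ 0 < (T ^+ m) i j.

Definition return_time T i (m : nat) : Prop := (0 < m)%N /\ 0 < (T ^+ m) i i.

(* [d] is the gcd of the possibly infinite set of return times of [i]; it is
   unique, and it is 0 exactly when [i] has no return time. *)
Definition index_period T i d : Prop :=
  (forall m, return_time T i m -> (d %| m)%N) /\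
  (forall c : nat, (forall m, return_time T i m -> (c %| m)%N) -> (c %| d)%N).

(* Meaningful for irreducible [T] with [0 < n]: all indices then have the same
   period. *)
Definition mx_period T d : Prop := forall i, index_period T i d.

Definition primitive_mx T : Prop := irreducible_mx T /\ mx_period T 1.

End NonnegativeMatrices.

Section Graph.

Variables (F : numFieldType) (n : nat) (e : rel 'I_n).

Definition out_set (u : 'I_n) : {set 'I_n} := [set v | e u v].

Definition hyperlink_mx : 'M[F]_n :=
  \matrix_(u, v) if v \in out_set u then #|out_set u|%:R^-1 else 0.

Variables (K : nat) (D : 'I_K -> {set 'I_n}).

Definition blocks : {set {set 'I_n}} := [set D k | k : 'I_K].

(* Injectivity makes D_1, ..., D_K an enumeration without repetition;
   [partition] includes that no block is empty. *)
Definition block_decomposition : Prop :=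
  injective D /\ partition blocks [set: 'I_n].

Definition block_of (u : 'I_n) : {set 'I_n} := pblock blocks u.

Definition proximal_blocks (u : 'I_n) : {set {set 'I_n}} :=
  [set block_of w | w in u |: out_set u].

Definition proximal_set (u : 'I_n) : {set 'I_n} :=
  \bigcup_(w in u |: out_set u) block_of w.

Definition num_proximal (u : 'I_n) : nat := #|proximal_blocks u|.

Definition proximity_mx : 'M[F]_n :=
  \matrix_(u, v)
    if v \in proximal_set u
    then ((num_proximal u)%:R * #|block_of v|%:R)^-1 else 0.

(* The factors A and R of M = R A. *)
Definition aggregation_mx : 'M[F]_(K, n) :=
  \matrix_(k, j) if j \in D k then 1 else 0.

Definition distribution_mx : 'M[F]_(n, K) :=
  \matrix_(i, j)
    if D j \in proximal_blocks i
    then ((num_proximal i)%:R * #|D j|%:R)^-1 else 0.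

Definition indicator_mx : 'M[F]_K := aggregation_mx *m distribution_mx.

Lemma proximity_mx_factor :
  block_decomposition -> proximity_mx = distribution_mx *m aggregation_mx.
Proof.
move=> [Dinj /and3P[/eqP Dcov Dtriv _]]; apply/matrixP=> u v; rewrite !mxE.
have covv x : x \in cover blocks by rewrite Dcov inE.
have /imsetP[k _ Dk] : pblock blocks v \in blocks by rewrite pblock_mem.
have vD j : (v \in D j) = (j == k).
  apply/idP/eqP=> [vDj|->]; last by rewrite -Dk mem_pblock.
  by apply: Dinj; rewrite -Dk; apply/esym/def_pblock => //; exact: imset_f.
rewrite (bigD1 k) //= big1 ?addr0 => [|j /negPf jk]; last first.
  by rewrite !mxE vD jk mulr0.
rewrite !mxE vD eqxx mulr1 -Dk; congr (if _ then _ else _).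
apply/bigcupP/imsetP=> -[w wu vw]; exists w => //.
  by apply: def_pblock => //; rewrite pblock_mem.
by rewrite -vw mem_pblock.
Qed.

End Graph.

Arguments hyperlink_mx F {n} e.
Arguments proximity_mx F {n} e {K} D.
Arguments aggregation_mx F {n K} D.
Arguments distribution_mx F {n} e {K} D.
Arguments indicator_mx F {n} e {K} D.

(* Main.v *)
(** The support of [P] is that of [M]: an edge [u -> v] puts [v] in the proximal
    set of [u], so [H] contributes no new positive entry. Each node lies in its
    own proximal set, so [P] and [W] have positive diagonals; this forces period
    1, and irreducibility becomes strong connectedness of the support digraph.
    Finally, sending a node to its block maps the support of [P] onto that of
    [W], and nodes of a common block are joined in the support of [P]; hence one
    digraph is strongly connected exactly when the other is. *)

Require Import Defs.
From mathcomp Require Import all_boot all_order all_algebra reals.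

Set Implicit Arguments.
Unset Strict Implicit.
Unset Printing Implicit Defensive.

Import Order.TTheory GRing.Theory Num.Theory.
Local Open Scope ring_scope.

(** Paths of [r] project along [b] edge by edge. Conversely, each edge of a path of [s] lifts to
    some edge of [r]; successive lifts need not share an endpoint, but the endpoints to be joined
    lie in one fibre of [b], where [r] holds. *)
Lemma connect_total_quotient (X Y : finType) (r : rel X) (s : rel Y)
    (b : X -> Y) :
  (forall y, exists x, b x = y) ->
  (forall u v, b u = b v -> r u v) ->
  (forall k l, reflect (exists u v, [/\ b u = k, b v = l & r u v]) (s k l)) ->
  (forall u v, connect r u v) <-> (forall k l, connect s k l).
Proof.
move=> bsurj rb sP; split=> [rT k l | sT u v].
  have [u <-] := bsurj k; have [v <-] := bsurj l.
  have /connectP[p pth ->] := rT u v.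
  elim: p u pth => [|w p IHp] u /=; first by rewrite connect0.
  move=> /andP[ruw /IHp]; apply: connect_trans; apply: connect1.
  by apply/sP; exists u, w.
have /connectP[p pth] := sT (b u) (b v).
(* The empty path only says that [u] and [v] share a fibre, so an edge within that fibre is still
   needed. *)
elim: p u pth => [|k p IHp] u /=; first by move=> _ /esym/rb; apply: connect1.
(* The lifted route is [u -> x -> y], its first edge inside the fibre of [u]; induction continues
   from [y]. *)
move=> /andP[/sP[x [y [bx <- rxy]]] pth lastp].
apply: connect_trans (IHp y pth lastp).
by apply: connect_trans (connect1 rxy); apply/connect1/rb.
Qed.

Section PositiveEntries.

Context (F : numFieldType).

Lemma psumr_gt0P (I : finType) (E : I -> F) :
  (forall i, 0 <= E i) -> reflect (exists i, 0 < E i) (0 < \sum_i E i).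
Proof.
move=> E0; rewrite lt0r sumr_ge0 // andbT psumr_neq0 //.
by apply: (iffP hasP) => -[i]; exists i; rewrite ?mem_index_enum.
Qed.

(** Without negative entries nothing cancels, so supports of matrices compose like relations. *)
Lemma mulmx_gt0P m n p (A : 'M[F]_(m, n)) (B : 'M[F]_(n, p)) i k :
  (forall i j, 0 <= A i j) -> (forall i j, 0 <= B i j) ->
  reflect (exists2 j, 0 < A i j & 0 < B j k) (0 < (A *m B) i k).
Proof.
move=> A0 B0; rewrite mxE.
apply: (iffP (psumr_gt0P _)) => [j|[j]|[j Aij Bjk]]; first exact: mulr_ge0.
  rewrite lt0r mulf_eq0 negb_or -andbA => /and3P[Aij Bjk _].
  by exists j; rewrite lt0r ?Aij ?Bjk ?A0 ?B0.
by exists j; apply: mulr_gt0.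
Qed.

Lemma nonneg_mxX n (T : 'M[F]_n) m : nonneg_mx T -> nonneg_mx (T ^+ m).
Proof.
move=> T0; elim: m => [|m IHm] i j; first by rewrite expr0 mxE ler0n.
by rewrite exprS mxE sumr_ge0 // => k _; rewrite mulr_ge0.
Qed.

Definition support_rel n (T : 'M[F]_n) : rel 'I_n := [rel i j | 0 < T i j].

(** A positive entry of [T ^+ m] is a walk of length [m] in the support. [connect] also admits the
    empty walk, which irreducibility excludes; the positive diagonal replaces it by a loop. *)
Lemma irreducible_mx_connect n (T : 'M[F]_n) :
  nonneg_mx T -> (forall i, 0 < T i i) ->
  irreducible_mx T <-> forall i j, connect (support_rel T) i j.
Proof.
move=> T0 Tdiag; split=> [[_ Tirr] i j | Tconn].
  have [m [_]] := Tirr i j; elim: m i => [|m IHm] i.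
    rewrite expr0 mxE; case: eqP => [->|_]; first by rewrite connect0.
    by rewrite ltxx.
  rewrite exprS => /(mulmx_gt0P _ _ T0 (nonneg_mxX _ T0))[k Tik Tkj].
  by apply: connect_trans (IHm k Tkj); apply: connect1.
split=> // i j; have /connectP[p pth ->] := Tconn i j.
elim: p i pth => [|k p IHp] i /=; first by exists 1%N; rewrite expr1.
move=> /andP[Tik /IHp[m [m_gt0 Tkj]]]; exists m.+1; split=> //; rewrite exprS.
by apply/(mulmx_gt0P _ _ T0 (nonneg_mxX _ T0)); exists k.
Qed.

(** A positive diagonal makes 1 a return time of every index, so any common divisor of the return
    times divides 1. *)
Lemma primitive_mx_irreducible n (T : 'M[F]_n) :
  (forall i, 0 < T i i) -> primitive_mx T <-> irreducible_mx T.
Proof.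
move=> Tdiag; split=> [[] //|Tirr]; split=> // i.
split=> [m _|c]; first exact: dvd1n.
by apply; split; rewrite ?expr1.
Qed.

End PositiveEntries.

Section Decomposition.

Context (F : numFieldType) (n : nat) (e : rel 'I_n).
Context (K : nat) (D : 'I_K -> {set 'I_n}).
Hypothesis hD : block_decomposition D.

(** Replaces the set-valued [block_of] by a map to block indices, the quotient map later fed to
    [connect_total_quotient]. *)
Lemma block_index :
  exists b : 'I_n -> 'I_K,
    [/\ forall u, block_of D u = D (b u),
        forall u k, (u \in D k) = (b u == k)
      & forall k, exists u, b u = k].
Proof.
have [Dinj /and3P[/eqP Dcov Dtriv D0]] := hD.
have covD x : x \in cover (blocks D) by rewrite Dcov inE.
have /fin_all_exists[b bE] u : exists k, block_of D u = D k.
  have /imsetP[k _ Dk] : block_of D u \in blocks D by rewrite pblock_mem.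
  by exists k.
have memD u k : (u \in D k) = (b u == k).
  apply/idP/eqP=> [uDk|<-]; last by rewrite -bE mem_pblock.
  by apply: Dinj; rewrite -bE; apply: def_pblock => //; apply: imset_f.
exists b; split=> // k.
have /set0Pn[u] : D k != set0.
  by apply: contraNneq D0 => <-; apply: imset_f.
by rewrite memD => /eqP <-; exists u.
Qed.

(** Blocks are pairwise disjoint, so a block of the union that contains [v] must be the block of
    [v]. *)
Lemma mem_proximal_set u v :
  (v \in proximal_set e D u) = (block_of D v \in proximal_blocks e D u).
Proof.
have [_ /and3P[/eqP Dcov Dtriv _]] := hD.
have covD x : x \in cover (blocks D) by rewrite Dcov inE.
apply/bigcupP/imsetP=> -[w wu vw]; exists w => //.
  by apply: def_pblock => //; rewrite pblock_mem.
by rewrite -vw mem_pblock.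
Qed.

Lemma proximal_set_neighbour u v :
  v \in u |: out_set e u -> v \in proximal_set e D u.
Proof. by move=> uv; rewrite mem_proximal_set; apply: imset_f. Qed.

Lemma num_proximal_gt0 u : (0 < num_proximal e D u)%N.
Proof.
apply/card_gt0P; exists (block_of D u); apply: imset_f.
exact: setU11.
Qed.

Lemma hyperlink_mx_ge0 : nonneg_mx (hyperlink_mx F e).
Proof. by move=> u v; rewrite mxE; case: ifP => // _; rewrite invr_ge0. Qed.

Lemma proximity_mx_ge0 : nonneg_mx (proximity_mx F e D).
Proof.
by move=> u v; rewrite mxE; case: ifP => // _; rewrite invr_ge0 mulr_ge0.
Qed.

Lemma proximity_mx_gt0 u v :
  (0 < proximity_mx F e D u v) = (v \in proximal_set e D u).
Proof.
rewrite mxE; case: ifP => _; last by rewrite ltxx.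
have [b [bE memD _]] := block_index.
rewrite invr_gt0 mulr_gt0 ?ltr0n ?num_proximal_gt0 //.
by apply/card_gt0P; exists v; rewrite bE memD.
Qed.

Lemma aggregation_mx_ge0 k u : 0 <= aggregation_mx F D k u.
Proof. by rewrite mxE; case: ifP. Qed.

Lemma distribution_mx_ge0 u k : 0 <= distribution_mx F e D u k.
Proof. by rewrite mxE; case: ifP => // _; rewrite invr_ge0 mulr_ge0. Qed.

Lemma aggregation_mx_gt0 k u : (0 < aggregation_mx F D k u) = (u \in D k).
Proof. by rewrite mxE; case: ifP; rewrite ?ltr01 ?ltxx. Qed.

Lemma distribution_mx_gt0 u k :
  (0 < distribution_mx F e D u k) = (D k \in proximal_blocks e D u).
Proof.
rewrite mxE; case: ifP => _; last by rewrite ltxx.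
have [b [_ memD bsurj]] := block_index; have [v bv] := bsurj k.
rewrite invr_gt0 mulr_gt0 ?ltr0n ?num_proximal_gt0 //.
by apply/card_gt0P; exists v; rewrite memD bv.
Qed.

Lemma indicator_mx_ge0 : nonneg_mx (indicator_mx F e D).
Proof.
move=> k l; rewrite mxE sumr_ge0 // => u _.
by rewrite mulr_ge0 ?aggregation_mx_ge0 ?distribution_mx_ge0.
Qed.

Lemma indicator_mx_gt0P k l :
  reflect (exists2 u, u \in D k & D l \in proximal_blocks e D u)
          (0 < indicator_mx F e D k l).
Proof.
apply: (iffP (mulmx_gt0P _ _ aggregation_mx_ge0 distribution_mx_ge0)) => -[u].
  by rewrite aggregation_mx_gt0 distribution_mx_gt0; exists u.
by exists u; rewrite ?aggregation_mx_gt0 ?distribution_mx_gt0.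
Qed.

End Decomposition.

Unset Implicit Arguments.
Set Strict Implicit.

Theorem theorem2 (R : realType) (n : nat) (hn : (0 < n)%N)
    (e : rel 'I_n) (hout : forall u : 'I_n, (1 <= #|out_set e u|)%N)
    (K : nat) (D : 'I_K -> {set 'I_n}) (hD : block_decomposition D)
    (eta mu : R) (heta : 0 < eta) (hmu : 0 < mu) (hsum : eta + mu = 1) :
  primitive_mx (eta *: hyperlink_mx R e + mu *: proximity_mx R e D)
  <-> irreducible_mx (indicator_mx R e D).
Proof.
set P := _ + _; set W := indicator_mx R e D.
have PE u v : P u v = eta * hyperlink_mx R e u v + mu * proximity_mx R e D u v.
  by rewrite !mxE.
have P0 : nonneg_mx P.
  move=> u v; rewrite PE addr_ge0 // mulr_ge0 ?(ltW heta) ?(ltW hmu) //.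
    exact: hyperlink_mx_ge0.
  exact: proximity_mx_ge0.
have Pgt0 u v : (0 < P u v) = (v \in proximal_set e D u).
  rewrite PE -(proximity_mx_gt0 R e hD); apply/idP/idP => [|Muv].
    (* Contrapositive: a node outside the proximal set is not an out-neighbour, so both summands
       vanish. *)
    apply: contraLR; rewrite proximity_mx_gt0 // => vNMu.
    have [vNu vMu] : v \notin out_set e u /\ proximity_mx R e D u v = 0.
      split; last by rewrite mxE (negPf vNMu).
      by apply: contra vNMu => uv; rewrite proximal_set_neighbour // setU1r.
    by rewrite vMu mxE (negPf vNu) !mulr0 addr0 ltxx.
  by rewrite ltr_wpDl ?mulr_gt0 // mulr_ge0 ?(ltW heta) ?hyperlink_mx_ge0.
have Pdiag u : 0 < P u u by rewrite Pgt0 proximal_set_neighbour // setU11.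
have [b [bE memD bsurj]] := block_index hD.
have proxb u v : (0 < P u v) = (D (b v) \in proximal_blocks e D u).
  by rewrite Pgt0 mem_proximal_set // bE.
(* By [proxb] the entry's positivity depends on [v] only through its block, here the block of [u]
   itself. *)
have rb u v : b u = b v -> support_rel P u v.
  by rewrite /support_rel /= proxb => <-; rewrite -bE imset_f ?setU11.
have WP k l : reflect (exists u v, [/\ b u = k, b v = l & support_rel P u v])
                      (support_rel W k l).
  apply: (iffP (indicator_mx_gt0P _ _ hD _ _)).
    (* Any node [v] of block [l] serves as target, again because [proxb] sees only its block. *)
    have [v <-] := bsurj l => -[u]; rewrite memD => /eqP bu uv.
    by exists u, v; rewrite /support_rel /= proxb.
  move=> [u [v [<- <-]]]; rewrite /support_rel /= proxb.
  by exists u; rewrite ?memD.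
have Wdiag k : 0 < W k k.
  by have [u <-] := bsurj k; apply/WP; exists u, u; split=> //; apply: rb.
have Wconn := irreducible_mx_connect (indicator_mx_ge0 _ _ _) Wdiag.
rewrite primitive_mx_irreducible // irreducible_mx_connect // Wconn.
exact: connect_total_quotient bsurj rb WP.
Qed.
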